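(* Let $\mathbf{X}$ be a metric space, let $\mathbf{K}$ be a nonempty compact subset of $C(\mathbf{T},\mathbf{X})$, let $\varnothing\neq\mathbf{V}\subset(comp)(\mathbf{K})$, and let $M\subset\mathbf{T}\times\mathbf{X}$ be closed. Let $\widetilde{\mathbf{V}}$ be the closure of $\mathbf{V}$ in $(comp)(\mathbf{K})$ with respect to the Vietoris topology. Then the value $C_M=\infty$ is rough in the original game (the game with set of bundles $\mathbf{V}$) if and only if the value $\widetilde{C}_M=\infty$ is precise in the extended game (the game with set of bundles $\widetilde{\mathbf{V}}$).
   Context: $\mathbf{T}=\{t\in\mathbb{R}: t\geqslant 0\}$. $C(\mathbf{T},\mathbf{X})$ is the space of continuous maps $\mathbf{T}\to\mathbf{X}$ with the compact-open topology. For a topological space $Y$, $(comp)(Y)$ is the set of all nonempty compact subsets of $Y$, with the Vietoris topology (for metrizable $Y$, the topology of the Hausdorff metric). For a closed set $N\subset\mathbf{T}\times\mathbf{X}$ and $x\in C(\mathbf{T},\mathbf{X})$ put $$c_N(x)=\inf\big(\{t\in\mathbf{T}: (t,x(t))\in N\}\cup\{+\infty\}\big),\qquad C_N=\sup_{\Phi\in\mathbf{V}}\inf_{x\in\Phi}c_N(x),\qquad \widetilde{C}_N=\sup_{\Phi\in\widetilde{\mathbf{V}}}\inf_{x\in\Phi}c_N(x).$$ Rough: the value $C_M=\infty$ is called rough (with respect to $M$) in the original game if there is a closed set $\widetilde{M}\subset\mathbf{T}\times\mathbf{X}$ with $M\subset\operatorname{int}\widetilde{M}$ (interior in $\mathbf{T}\times\mathbf{X}$)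 such that $C_{\widetilde{M}}=\infty$. Precise: the value $\widetilde{C}_M=\infty$ is called precise in the extended game if there is $\Phi\in\widetilde{\mathbf{V}}$ such that $(t,x(t))\notin M$ for all $x\in\Phi$ and all $t\in\mathbf{T}$ (which implies $\widetilde{C}_M=\infty$). *)

(* Defs.v *)
From HB Require Import structures.
From mathcomp Require Import all_boot all_order all_algebra.
From mathcomp Require Import all_classical all_reals all_analysis.

Set Implicit Arguments.
Unset Strict Implicit.
Unset Printing Implicit Defensive.

Import Order.TTheory GRing.Theory Num.Theory.
Import numFieldNormedType.Exports.

(* Equips [continuousType U V] with the compact-open topology. *)
Import ArrowAsCompactOpen.

Local Open Scope classical_set_scope.
Local Open Scope ring_scope.

(* Used as a type through the coercion [set_type], hence with the topology
   induced from R. *)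
Definition halfline (R : realType) : set R := [set t | 0 <= t].
Arguments halfline R : clear implicits.

Definition compacts (Y : topologicalType) : Type :=
  set_type [set A : set Y | A !=set0 /\ compact A].

HB.instance Definition _ (Y : topologicalType) := Choice.on (compacts Y).

Definition compact_val (Y : topologicalType) (Phi : compacts Y) : set Y :=
  \val Phi.
Coercion compact_val : compacts >-> set.

Section Vietoris.
Variable Y : topologicalType.

Definition vietoris_sub (G : set Y) : set (compacts Y) :=
  [set Phi | Phi `<=` G].

Definition vietoris_hit (G : set Y) : set (compacts Y) :=
  [set Phi | Phi `&` G !=set0].

Definition vietoris_subbase : set_system (compacts Y) :=
  [set vietoris_sub G | G in @open Y] `|` [set vietoris_hit G | G in @open Y].

HB.instance Definition _ :=
  isSubBaseTopological.Build (compacts Y) vietoris_subbase id.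

End Vietoris.

Section Game.
Variables (R : realType) (X : metricType R).

Let TX : topologicalType := (halfline R * X)%type.
Let CTX : topologicalType := continuousType (halfline R) X.

Definition hitting_time (N : set TX) (x : CTX) : \bar R :=
  ereal_inf ([set (\val t)%:E | t in [set t : halfline R | N (t, x t)]]
             `|` [set +oo%E]).

Variables (K : set CTX).

(* A bundle is a compact subset of the subspace K, so its elements are points
   of [set_type K]; [\val] maps them back to C(T, X). *)
Definition game_value (V : set (compacts K)) (N : set TX) : \bar R :=
  ereal_sup [set ereal_inf [set hitting_time N (\val x) | x in (Phi : set K)]
            | Phi in V].

Definition rough (V : set (compacts K)) (M : set TX) : Prop :=
  exists Mt : set TX,
    [/\ closed Mt, M `<=` interior Mt & game_value V Mt = +oo%E].

Definition precise (V : set (compacts K)) (M : set TX) : Prop :=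
  exists2 Phi : compacts K, V Phi &
    forall (x : K) (t : halfline R), (Phi : set K) x -> ~ M (t, (\val x : CTX) t).

End Game.

(* Main.v *)
Require Import Defs.
From mathcomp Require Import all_boot all_order all_algebra.
From mathcomp Require Import finmap.
From mathcomp Require Import all_classical all_reals all_analysis.

Import Order.TTheory GRing.Theory Num.Theory.
Import numFieldNormedType.Exports.
Import ArrowAsCompactOpen.

Local Open Scope classical_set_scope.
Local Open Scope ring_scope.

(** The game value is infinite exactly when, for every horizon [a], some
admissible bundle has all its trajectories off the target up to time [a]
([game_value_pinftyP]).  The theorem compares this family of finite-horizon
bundles with a single bundle avoiding the target forever.

From rough to precise: the hyperspace of nonempty compact subsets of the compact
space [K] is itself compact in the Vietoris topology ([vietoris_compact]), so
bundles of [V] avoiding the enlarged target [Mt] up to larger and larger times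
accumulate at some [Phi] in the closure of [V].  If a trajectory of [Phi] met
[M] at time [t], then it would be inside the interior of [Mt] at time [t]; this
is an open condition on trajectories, so bundles of arbitrarily large horizon
would hit [Mt] at time [t], which is absurd once the horizon exceeds [t].

From precise to rough: because [Phi] is compact and trajectories evaluate
jointly continuously ([graph_point_continuous], which rests on the local
compactness of the time axis), the union of the graphs of the trajectories of
[Phi] is closed ([bundle_graph_closed]).  It is disjoint from [M], so normality
of the metrizable space of positions gives an open neighbourhood of [M] whose
closure still misses that union; this closure is the enlarged target.  Avoiding
a closed set up to a finite time is an open condition on trajectories
([avoids_open]), so it passes from [Phi] to some nearby bundle of [V], at each
horizon. *)

(** * Compactness of the Vietoris hyperspace *)

Section VietorisTopology.
Variable Y : topologicalType.

Lemma vietoris_open_sub (G : set Y) : open G -> open (vietoris_sub G).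
Proof.
move=> oG; exists [set vietoris_sub G]; last by rewrite bigcup_set1.
move=> _ ->; exists [fset vietoris_sub G]%fset.
  by move=> A /fset1P ->; apply/mem_set; left; exists G.
by rewrite set_fset1 bigcap_set1.
Qed.

Lemma vietoris_open_hit (G : set Y) : open G -> open (vietoris_hit G).
Proof.
move=> oG; exists [set vietoris_hit G]; last by rewrite bigcup_set1.
move=> _ ->; exists [fset vietoris_hit G]%fset.
  by move=> A /fset1P ->; apply/mem_set; right; exists G.
by rewrite set_fset1 bigcap_set1.
Qed.

Lemma vietoris_cvg (F : set_system (compacts Y)) (Phi : compacts Y) :
  Filter F ->
  (forall G, open G -> Phi `<=` G -> F (vietoris_sub G)) ->
  (forall G, open G -> Phi `&` G !=set0 -> F (vietoris_hit G)) ->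
  F --> Phi.
Proof.
move=> FF Fsub Fhit A; rewrite nbhsE => -[B [[D' DD' <-]] [C D'C CPhi] BA].
apply: (@filterS _ F _ C); first by move=> x Cx; apply: BA; exists C.
have [E EV EC] := DD' _ D'C.
rewrite -EC; apply: filter_bigI => S SE.
have SPhi : S Phi by move: CPhi; rewrite -EC; apply.
have /set_mem[[G oG GS]|[G oG GS]] := EV _ SE; move: SPhi; rewrite /= -GS.
  exact: Fsub.
exact: Fhit.
Qed.

(** For an ultrafilter of bundles, the points every neighbourhood of which is hit
by almost all bundles: their upper and lower Kuratowski limit at once, since an
ultrafilter decides each hit set. *)
Definition limit_bundle (F : set_system (compacts Y)) : set Y :=
  [set x | forall U, open U -> U x -> F (vietoris_hit U)].

Lemma limit_bundle_closed (F : set_system (compacts Y)) :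
  closed (limit_bundle F).
Proof.
move=> x clx U oU Ux.
have [y [Ly Uy]] := clx U (open_nbhs_nbhs (conj oU Ux)).
exact: Ly.
Qed.

(** A compact set off the limit is missed by almost all bundles: each of its
points has a neighbourhood that almost all bundles miss, and finitely many of
these neighbourhoods suffice. *)
Lemma limit_bundle_miss (F : set_system (compacts Y)) (C : set Y) :
  UltraFilter F -> compact C -> C `&` limit_bundle F = set0 ->
  F [set Phi : compacts Y | C `<=` ~` (Phi : set Y)].
Proof.
move=> FU /compact_near_coveringP cC CL.
apply: (cC _ F (fun (Phi : compacts Y) x => ~ (Phi : set Y) x)) => x Cx.
have : ~ limit_bundle F x by move=> Lx; rewrite -[False]/(set0 x) -CL.
move=> /existsNP[U /not_implyP[oU /not_implyP[Ux nFU]]].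
have [//|FCU] := in_ultra_setVsetC (vietoris_hit U) FU.
exists (U, ~` vietoris_hit U).
  by split=> //=; exact: open_nbhs_nbhs.
move=> [y Phi] /= [Uy nhit] Phiy; apply: nhit; exists y; split=> //.
Qed.

(** An ultrafilter converges to its limit bundle.  The hit sets are neighbourhoods
by definition of the limit; for the subset condition [limit_bundle_miss] is
applied to the complement of the open set, and applied to the whole space it
shows that the limit is nonempty. *)
Lemma vietoris_compact : compact [set: Y] -> compact [set: compacts Y].
Proof.
move=> cY; rewrite compact_ultra => F FU _.
have cL : compact (limit_bundle F).
  exact: subclosed_compact (@limit_bundle_closed F) cY (@subsetT _ _).
have L0 : limit_bundle F !=set0.
  apply/set0P/eqP => L0.
  have /filter_ex[Phi missPhi] : F [set Phi : compacts Y | setT `<=` ~` (Phi : set Y)].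
    by apply: limit_bundle_miss => //; rewrite L0 setI0.
  have [[x Phix] _] := set_valP Phi.
  exact: (missPhi x).
pose Phi : compacts Y := SigSub (mem_set (conj L0 cL)).
exists Phi; split=> //; apply: vietoris_cvg => G oG.
  move=> PhiG.
  have : F [set Psi : compacts Y | ~` G `<=` ~` (Psi : set Y)].
    apply: limit_bundle_miss.
      exact: subclosed_compact (open_closedC oG) cY (@subsetT _ _).
    by apply/seteqP; split => // x [nGx Lx]; exact/nGx/PhiG.
  by apply: filterS => Psi /subsetCP.
by move=> [x [Lx Gx]]; exact: Lx.
Qed.

End VietorisTopology.

(** * Compactness in subspaces and on the time axis *)

Lemma compact_set_type (Z : topologicalType) (K : set Z) :
  compact K -> compact [set: K].
Proof.
move=> cK F FF _.
have FK : F ((\val : K -> Z) @^-1` K).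
  by apply: (@filterE _ F) => x; exact: (set_valP x).
have [p [Kp clp]] := cK ((\val : K -> Z) @ F) _ FK.
exists (SigSub (mem_set Kp)); split=> // A B FA [U [[W oW <-] Wp UB]].
have [_ [[y Ay <-] Wy]] := clp ((\val : K -> Z) @` A) W
  (filterS (@preimage_image _ _ _ A) FA) (open_nbhs_nbhs (conj oW Wp)).
by exists y; split=> //; exact: UB.
Qed.

Section HalfLine.
Variable R : realType.

Lemma halfline_val_continuous : continuous (\val : halfline R -> R).
Proof. exact: initial_continuous. Qed.

Lemma halfline_segment_compact (a : R) :
  compact [set t : halfline R | \val t <= a].
Proof.
have P (r : R) : halfline R (Num.max 0 r) by rewrite /halfline /= le_max lexx.
(* The segment is the image of [0, a] under the retraction of the line onto the
     half-line. *)
pose f (r : R) : halfline R := SigSub (mem_set (P r)).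
have cf : continuous f.
  apply: continuous_comp_initial => r.
  apply: (@continuous_max _ _ (cst 0) id); [exact: cvg_cst|exact: cvg_id].
have -> : [set t : halfline R | \val t <= a] = f @` `[0, a].
  apply/seteqP; split=> [t ta|_ [r /= + <-]].
    have t0 : 0 <= \val t := set_valP t.
    exists (\val t); first by rewrite /= in_itv /= t0.
    by apply: val_inj; rewrite /= max_r.
  by rewrite in_itv /= ge_max => /andP[r0 ra]; rewrite ra (le_trans r0 ra).
apply: continuous_compact; last exact: segment_compact.
exact: continuous_subspaceT.
Qed.

Lemma halfline_locally_compact : locally_compact [set: halfline R].
Proof.
move=> t _; rewrite withinET.
exists [set s : halfline R | \val s <= \val t + 1].
  have : \forall s \near (\val t : R), s <= \val t + 1.
    have : \val t < \val t + 1 by rewrite ltrDl.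
    by move/lt_nbhsl; apply: filterS => s /ltW.
  exact: halfline_val_continuous.
split; first exact: halfline_segment_compact.
apply: (@preimage_closed _ _ (\val : halfline R -> R) [set r | r <= \val t + 1]).
  by move=> s _; exact: halfline_val_continuous.
exact: closed_le.
Qed.

End HalfLine.

(** * Trajectories and their graphs *)

Section Trajectories.
Variables (R : realType) (X : metricType R).

Local Notation TX := (halfline R * X)%type.
Local Notation CTX := (continuousType (halfline R) X).

Lemma graph_point_continuous :
  continuous (fun p : halfline R * CTX => (p.1, p.2 p.1) : TX).
Proof.
move=> [t x]; apply: (@cvg_pair _ _ _ (nbhs (t, x)) (nbhs t) (nbhs (x t)) _ _ _
  fst (fun p : halfline R * CTX => p.2 p.1)); first exact: cvg_fst.
apply: (@continuous_comp _ _ _ _ eval (t, x) (@swap_continuous _ _ _)).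
apply: eval_continuous; first exact: halfline_locally_compact.
exact: uniform_regular.
Qed.

Definition avoids (N : set TX) (a : R) (x : CTX) :=
  forall t : halfline R, \val t <= a -> ~ N (t, x t).

(** The tube lemma: only the compact time segment up to [a] matters. *)
Lemma avoids_open (N : set TX) (a : R) : closed N -> open (avoids N a).
Proof.
move=> cN; rewrite openE => x ax.
have /compact_near_coveringP cov := @halfline_segment_compact R a.
apply: (cov _ (nbhs x) (fun (y : CTX) t => ~ N (t, y t))) => t ta.
apply: (@graph_point_continuous (t, x) (~` N)).
by apply: open_nbhs_nbhs; split; [exact: closed_openC|exact: ax].
Qed.

(** At a position [p] off all graphs, each trajectory [x] of [L] is separated
from [p]: if [A] and [B] are disjoint neighbourhoods of [p.2] and [x p.1], then
trajectories near [x] stay in [B] at times near [p.1].  Compactness of [L] makes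
the neighbourhood of [p] uniform in [x]. *)
Lemma bundle_graph_closed (L : set CTX) : compact L ->
  closed [set p : TX | exists2 x, L x & p.2 = x p.1].
Proof.
move=> /compact_near_coveringP cL; rewrite -openC openE => p np.
suff : \forall q \near p, L `<=` (fun x : CTX => q.2 <> x q.1).
  by apply: filterS => q Lq [x /Lq].
apply: (cL _ (nbhs p) (fun (q : TX) (x : CTX) => q.2 <> x q.1)) => x Lx.
have /eqP px : p.2 <> x p.1 by move=> px; apply: np; exists x.
have := @metric_hausdorff _ X; rewrite open_hausdorff => /(_ _ _ px).
move=> [[A B] /=]; rewrite !inE => -[Ap Bx] [oA oB AB0].
have : nbhs (p.1, x : CTX) [set q : halfline R * CTX | B (q.2 q.1)].
  have nB : nbhs (p.1, x p.1) [set q : TX | B q.2].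
    by apply: cvg_snd; apply: open_nbhs_nbhs.
  exact: (@graph_point_continuous (p.1, x) _ nB).
move=> [[U W] /= [Up Wx] UWB].
exists (W, [set q : TX | U q.1 /\ A q.2]) => /=.
  split=> //; exists (U, A) => //=; split=> //; exact: open_nbhs_nbhs.
move=> [y q] /= [Wy [Uq Aq]] qy.
suff : (A `&` B) q.2 by rewrite AB0.
by split=> //; rewrite qy; apply: (UWB (q.1, y)).
Qed.

(** * Game values and avoidance up to a horizon *)

Lemma hitting_time_ge (N : set TX) (a : R) (x : CTX) :
  avoids N a x -> (a%:E <= hitting_time N x)%E.
Proof.
move=> ax; apply/ereal_infP => _ [[t Nt <-]|->]; last by rewrite leey.
by rewrite lee_fin leNgt; apply/negP => /ltW /ax.
Qed.

Lemma hitting_time_gt (N : set TX) (a : R) (x : CTX) :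
  (a%:E < hitting_time N x)%E -> avoids N a x.
Proof.
move=> + t ta Nt; apply/negP; rewrite -leNgt.
apply: (@le_trans _ _ (\val t)%:E); last by rewrite lee_fin.
by apply: ereal_inf_lbound; left; exists t.
Qed.

(** Avoidance up to time [a] gives only a weak lower bound on hitting times and
follows only from a strict one; the gap closes because [a] is arbitrary. *)
Lemma game_value_pinftyP (K : set CTX) (V : set (compacts K)) (N : set TX) :
  game_value V N = +oo%E <->
  forall a, exists2 Phi, V Phi & forall x, (Phi : set K) x -> avoids N a (\val x).
Proof.
split=> [Voo a|Va].
  have : (a%:E < game_value V N)%E by rewrite Voo ltry.
  move=> /ereal_sup_gt[_ [Phi VPhi <-]] aPhi; exists Phi => // x Phix.
  apply/hitting_time_gt/(lt_le_trans aPhi).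
  by apply: ereal_inf_lbound; exists x.
apply/eqyP => a _; have [Phi VPhi aPhi] := Va a.
apply: (@le_trans _ _ (ereal_inf [set hitting_time N (\val x) | x in (Phi : set K)])).
  by apply/ereal_infP => _ [x Phix <-]; exact/hitting_time_ge/aPhi.
by apply: ereal_sup_ubound; exists Phi.
Qed.

(** * The two implications *)

(** The position at the fixed time [t] depends continuously on the trajectory. *)
Lemma position_open (K : set CTX) (G : set TX) (t : halfline R) :
  open G -> open [set y : K | G (t, (\val y : CTX) t)].
Proof.
move=> oG; apply: (@open_comp _ _ _ G) => // y _.
apply: (@continuous_comp _ _ _ (fun z : K => (t, \val z : CTX))
  (fun p : halfline R * CTX => (p.1, p.2 p.1))); last first.
  exact: graph_point_continuous.
apply: (@cvg_pair _ _ _ (nbhs y) (nbhs t) (nbhs (\val y : CTX)) _ _ _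
  (cst t) \val); first exact: cvg_cst.
exact: initial_continuous.
Qed.

Lemma rough_precise (K : set CTX) (V : set (compacts K)) (M : set TX) :
  compact K -> rough V M -> precise (closure V) M.
Proof.
move=> cK [Mt [cMt MMt /game_value_pinftyP Voo]].
pose tail (a : R) := [set Phi : compacts K |
  V Phi /\ forall x : K, (Phi : set K) x -> avoids Mt a (\val x)].
pose F := filter_from [set: R] tail.
have FF : ProperFilter F.
  apply: filter_from_proper; last first.
    by move=> a _; have [Phi] := Voo a; exists Phi.
  apply: filter_from_filter; first by exists 0.
  move=> a b _ _; exists (Num.max a b) => // Phi [VPhi aPhi].
  split; split=> // x Phix t tab; apply: (aPhi x Phix).
    by rewrite le_max tab.
  by rewrite le_max tab orbT.
have [Phi [_ clPhi]] :=
  vietoris_compact _ (compact_set_type _ _ cK) F FF filterT.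
exists Phi.
  move=> A nA; have FV : F V by exists 0 => // Psi [].
  exact: clPhi.
move=> x t Phix Mxt.
pose U := [set y : K | interior Mt (t, (\val y : CTX) t)].
have nU : nbhs Phi (vietoris_hit U).
  apply: open_nbhs_nbhs; split.
    exact/vietoris_open_hit/position_open/open_interior.
  by exists x; split=> //; exact: MMt.
have Ft : F (tail (\val t)) by exists (\val t).
have [Psi [[_ avPsi] [y [Psiy Uy]]]] := clPhi _ _ Ft nU.
by apply: (avPsi y Psiy t) => //; exact: interior_subset.
Qed.

Lemma precise_rough (K : set CTX) (V : set (compacts K)) (M : set TX) :
  closed M -> precise (closure V) M -> rough V M.
Proof.
move=> cM [Phi clPhi missPhi].
pose L : set CTX := \val @` (Phi : set K).
have cL : compact L.
  apply: continuous_compact; last by have [] := set_valP Phi.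
  by apply: continuous_subspaceT; exact: initial_continuous.
have [|A [B [oA oB MA GB AB0]]] := (normal_openP (R := R)).1
    pseudometric_normal _ _ cM (bundle_graph_closed _ cL).
  apply/seteqP; split=> // -[t y] [Mty [x [z Phiz <-] /= yx]].
  by apply: (missPhi z t Phiz); rewrite -yx.
exists (closure A); split; first exact: closed_closure.
  apply: (subset_trans MA); rewrite -[X in X `<=` _](interior_id _).1 //.
  exact/interiorS/subset_closure.
have AB : closure A `<=` ~` B.
  rewrite [X in _ `<=` X](closure_id _).1; last exact: open_closedC.
  by apply: closureS; apply/disjoints_subset.
apply/game_value_pinftyP => a.
pose U := [set x : K | avoids (closure A) a (\val x)].
have oU : open U.
  apply: (@open_comp _ _ (\val : K -> CTX) (avoids (closure A) a)).
    by move=> y _; exact: initial_continuous.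
  exact/avoids_open/closed_closure.
have [Psi [VPsi PsiU]] : V `&` vietoris_sub U !=set0.
  apply: clPhi; apply: open_nbhs_nbhs; split; first exact: vietoris_open_sub.
  move=> x Phix t _ /AB; apply; apply: GB; exists (\val x) => //.
  by exists x.
by exists Psi.
Qed.

End Trajectories.

Theorem mainTheorem2 (R : realType) (X : metricType R)
    (K : set (continuousType (halfline R) X)) (V : set (compacts K))
    (M : set (halfline R * X)) :
  K !=set0 -> compact K -> V !=set0 -> closed M ->
  rough V M <-> precise (closure V) M.
Proof.
by move=> _ cK _ cM; split; [exact: rough_precise|exact: precise_rough].
Qed.
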